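(* For $l\in[\xi(x_0),l_B]$ let $$\mathrm{Loss}(l) = 2U(x_0,\{\xi=l_B\}) - \inf_{x\in\{\xi=l\}}\big[U^{(l)}(x_0,x)+2U(x,\{\xi=l_B\})\big] - U(x_0,\{\xi=l\}).$$ Then $\mathrm{Loss}(l)\ge0$ for all $l\in[\xi(x_0),l_B]$. If for some $l\in[\xi(x_0),l_B]$ there is a state $x_*(l)\in\{\xi=l\}$ such that $$U(x_0,x_*(l))=U(x_0,\{\xi=l\})\quad\text{and}\quad U(x_*(l),\{\xi=l_B\})=U(\{\xi=l\},\{\xi=l_B\}),$$ then $\mathrm{Loss}(l)=0$.
   Context: $E$ is a Polish space, $A\subset E$ a (Borel) reference set, $\xi:E\to\mathbb R$ is continuous, $x_0\in E$ is a fixed initial condition and $l_B\ge\xi(x_0)$ is a target level. For each $T>0$, $I_{[0,T]}:C([0,T],E)\to[0,+\infty]$ is the good rate function of the large deviation principle (uniform topology, $\varepsilon\to0$) satisfied by a family $(\mathbf X^\varepsilon)_{\varepsilon>0}$ of time-homogeneous continuous strong Markov processes, for every initial condition $x$ (only paths with $\mathbf x_0=x$ being counted), locally uniformly in the initial condition. The rate functions are additive: $I_{[0,T']}=I_{[0,T]}+I_{[T,T']}$ for $T\le T'$, where $I_{[T,T']}$ is the rate function on $[T,T']$ (i.e. $I_{[0,T'-T]}$ of the time-shifted path). $U(x,y)=\inf\{I_{[0,T]}(\mathbf x): T>0,\ \mathbf x\in C([0,T],E\setminus A),\ \mathbf x_0=x,\ \mathbf x_T=y\}$. For $x\in\{\xi\le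 l\}$ and $y\in\{\xi=l\}$, $U^{(l)}(x,y)$ is the same infimum restricted to paths $\mathbf x\in C([0,T],\{\xi\le l\}\setminus A)$. For sets, $U(C_1,C_2)=\inf_{x\in C_1,y\in C_2}U(x,y)$, $U(x,C)=U(\{x\},C)$, and similarly for $U^{(l)}$. The infimum of the empty set is $+\infty$. It is assumed that $U(x_0,\{\xi=l_B\})<+\infty$.
   Formalization: In the definitions of U and U^(l), duration T = 0 (constant path, cost I_[0,0] = 0) is also allowed, so U(x,x) = 0 off A; with T > 0 only, Loss can be −∞ at l = ξ(x_0) or l = l_B (e.g. the flow x' = 1 on ℝ). *)

(* Defs.v *)
From HB Require Import structures.
From mathcomp Require Import all_boot all_order all_algebra.
From mathcomp Require Import all_classical all_reals all_analysis.
From mathcomp Require Import measurable_realfun.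

Set Implicit Arguments.
Unset Strict Implicit.
Unset Printing Implicit Defensive.

Import Order.TTheory GRing.Theory Num.Def Num.Theory.
Import numFieldNormedType.Exports.

Local Open Scope classical_set_scope.
Local Open Scope ring_scope.
Local Open Scope ereal_scope.

(* A Polish space is given with a compatible complete metric (completeness is
   part of [completePseudoMetricType]).  The uniform topology on C([0,T],E) used
   below does not depend on that choice, since [0,T] is compact. *)
Definition polish (R : realType) (E : completePseudoMetricType R) : Prop :=
  hausdorff_space E /\ exists2 S : set E, countable S & dense S.

Definition borel (E : topologicalType) : set_system E := <<s @open E >>.

(* Only the values [mp_path t] with [0 <= t] matter, and likewise for
   [mp_filt t]. *)
Record strong_markov_process (R : realType) (E : completePseudoMetricType R) :=
  StrongMarkovProcess {
  mp_disp : measure_display ;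
  mp_sample : measurableType mp_disp ;
  mp_filt : R -> set_system mp_sample ;
  mp_path : R -> mp_sample -> E ;
  mp_law : E -> probability mp_sample R ;
  mp_filt_sigma : forall t : R, (0 <= t)%R ->
    sigma_algebra setT (mp_filt t) /\ mp_filt t `<=` measurable ;
  mp_filt_mono : forall s t : R, (0 <= s)%R -> (s <= t)%R ->
    mp_filt s `<=` mp_filt t ;
  mp_adapted : forall (t : R) B, (0 <= t)%R -> borel B ->
    mp_filt t (mp_path t @^-1` B) ;
  mp_continuous : forall w,
    {within `[0%R, +oo[, continuous (fun t => mp_path t w)} ;
  mp_init : forall x, mp_law x (mp_path 0%R @^-1` [set x]) = 1 ;
  mp_kernel : forall (t : R) B, (0 <= t)%R -> borel B ->
    measurable_fun setT (fun y : g_sigma_algebraType (@open E) =>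
      mp_law y (mp_path t @^-1` B)) ;
  (* [tau] is a stopping time and [G] an event of its sigma-algebra F_tau; the
     kernel on the right-hand side does not depend on [tau]: the process is
     time-homogeneous. *)
  mp_strong_markov : forall (tau : mp_sample -> \bar R) (G : set mp_sample),
    (forall w, 0 <= tau w) ->
    (forall s : R, (0 <= s)%R -> mp_filt s [set w | tau w <= s%:E]) ->
    (forall s : R, (0 <= s)%R -> mp_filt s (G `&` [set w | tau w <= s%:E])) ->
    forall x (t : R) B, (0 <= t)%R -> borel B ->
      mp_law x (G `&` [set w | tau w < +oo]
                  `&` [set w | B (mp_path (fine (tau w) + t)%R w)]) =
      \int[mp_law x]_(w in G `&` [set w | tau w < +oo])
        mp_law (mp_path (fine (tau w)) w) (mp_path t @^-1` B)
}.

(* C([0,T],E): elements are represented by functions R -> E, of which only the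
   values on [0,T] are relevant; the uniform topology is that of
   [{uniform` `[0, T] -> E}], a copy of the type R -> E. *)
Definition cpath (R : realType) (E : completePseudoMetricType R) (T : R) :
    set (R -> E) :=
  [set f | {within `[0%R, T], continuous f}].

Definition cpath_from (R : realType) (E : completePseudoMetricType R) (T : R)
    (x : E) : set (R -> E) :=
  cpath T `&` [set f | f 0%R = x].

(* [I T] is the functional I_[0,T] on C([0,T],E).  Goodness is required of the
   rate functions attached to each initial condition, in which only the paths
   issued from that point count.  The degenerate interval [0,0] carries no
   cost. *)
Record good_additive_rate (R : realType) (E : completePseudoMetricType R)
    (I : R -> (R -> E) -> \bar R) : Prop := GoodAdditiveRate {
  rate_ge0 : forall (T : R) f, (0 <= T)%R -> cpath T f -> 0 <= I T f ;
  rate_local : forall (T : R) f g, (0 <= T)%R -> cpath T f -> cpath T g ->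
    {in `[0%R, T], f =1 g} -> I T f = I T g ;
  rate_0 : forall f, I 0%R f = 0 ;
  rate_lsc : forall T : R, (0 < T)%R ->
    lower_semicontinuous
      (I T : subspace (cpath T : set {uniform` `[0%R, T] -> E}) -> \bar R) ;
  rate_compact : forall (T : R) x a, (0 < T)%R ->
    compact (cpath_from T x `&` [set f | I T f <= a%:E] :
      set {uniform` `[0%R, T] -> E}) ;
  rate_additive : forall (S T : R) f, (0 <= S)%R -> (S <= T)%R -> cpath T f ->
    I T f = I S f + I (T - S)%R (fun t => f (S + t)%R)
}.

(* eps log P^eps_y (X^eps restricted to [0,T] belongs to O) *)
Definition log_prob (R : realType) (E : completePseudoMetricType R)
    (X : R -> strong_markov_process E) (O : set (R -> E)) (p : R * E) : \bar R :=
  p.1%:E * lne (mp_law (X p.1) p.2 [set w | O (fun t => mp_path t w)]).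

(* Large deviation principle on C([0,T],E), locally uniform in the initial
   condition: the limits are taken as eps -> 0+ and y -> x jointly (y = x being
   allowed). *)
Definition locally_uniform_LDP (R : realType) (E : completePseudoMetricType R)
    (X : R -> strong_markov_process E) (I : R -> (R -> E) -> \bar R) (T : R) :
    Prop :=
  forall x : E,
    (forall O : set {uniform` `[0%R, T] -> E}, open O ->
       - ereal_inf (I T @` (O `&` cpath_from T x)) <=
       limf_einf (log_prob X O) (filter_prod (0%R : R)^'+ (nbhs x))) /\
    (forall F : set {uniform` `[0%R, T] -> E}, closed F ->
       limf_esup (log_prob X F) (filter_prod (0%R : R)^'+ (nbhs x)) <=
       - ereal_inf (I T @` (F `&` cpath_from T x))).

Section quasipotential.
Context {R : realType} {E : completePseudoMetricType R}.
Variable I : R -> (R -> E) -> \bar R.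
Implicit Types (D C : set E) (x y : E).

(* Costs of the paths from [x] to [y] staying in [D], with duration in [J]. *)
Definition path_costs (J : set R) D x y : set (\bar R) :=
  [set c | exists T f, [/\ J T, cpath T f, f 0%R = x /\ f T = y,
                           f @` `[0%R, T] `<=` D & c = I T f]].

(* The duration T = 0 is allowed, so that the constant path at [x] gives
   U(x,x) = 0 for [x] in [D].  With T > 0 only, reaching {xi = l} from a point
   that already lies in it may be costly or impossible (take the deterministic
   flow of a vector field without recurrence), and Loss may be -oo at
   l = xi x0 and at l = lB.  This affects U only on the diagonal, see
   [quasipotential_offdiag]. *)
Definition quasipotential D x y : \bar R :=
  ereal_inf (path_costs `[0%R, +oo[ D x y).

Lemma quasipotential_offdiag D x y : x <> y ->
  quasipotential D x y = ereal_inf (path_costs `]0%R, +oo[ D x y).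
Proof.
move=> xy; congr ereal_inf; apply/seteqP.
split=> c [T [f [JT cf [f0 fT] fD ->]]]; exists T, f; split=> //.
- move: JT; rewrite /= !in_itv/= !andbT le_eqVlt => /orP[/eqP T0|//].
  by case: xy; rewrite -f0 -fT -T0.
- by move: JT; rewrite /= !in_itv/= !andbT; exact: ltW.
Qed.

Definition quasipotential_set D (C1 C2 : set E) : \bar R :=
  ereal_inf [set u | exists x y, [/\ C1 x, C2 y & u = quasipotential D x y]].

Variables (A : set E) (xi : E -> R).

Definition level (l : R) : set E := [set z | xi z = l].

Definition U x y := quasipotential (~` A) x y.
Definition Uset C1 C2 := quasipotential_set (~` A) C1 C2.
Definition Ul (l : R) x y :=
  quasipotential ([set z | (xi z <= l)%R] `\` A) x y.

Definition Loss (x0 : E) (lB l : R) : \bar R :=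
  2%:E * Uset [set x0] (level lB)
  - ereal_inf [set Ul l x0 x + 2%:E * Uset [set x] (level lB) | x in level l]
  - Uset [set x0] (level l).

End quasipotential.

(* Main.v *)
(* Paths from x0 to the target must cross {xi = l}.  Cutting such a path at its
   first crossing time, and using additivity of the rate, bounds twice its cost
   from below by U^(l)(x0,x) + U(x0,{xi=l}) + 2 U(x,{xi=lB}) with x the crossing
   point: hence Loss >= 0.  Conversely, concatenating paths at x_* gives
   U(x0,{xi=lB}) <= U(x0,{xi=l}) + U({xi=l},{xi=lB}), whose double is a lower
   bound of every U^(l)(x0,x) + 2 U(x,{xi=lB}) + U(x0,{xi=l}). *)
Require Import Defs.
From HB Require Import structures.
From mathcomp Require Import all_boot all_order all_algebra.
From mathcomp Require Import all_classical all_reals all_analysis.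
From mathcomp Require Import measurable_realfun.
From mathcomp Require Import lra.

Set Implicit Arguments.
Unset Strict Implicit.
Unset Printing Implicit Defensive.

Import Order.TTheory GRing.Theory Num.Def Num.Theory.
Import numFieldNormedType.Exports.

Local Open Scope classical_set_scope.
Local Open Scope ring_scope.
Local Open Scope ereal_scope.

Lemma le_ereal_infD (R : realType) (S1 S2 : set (\bar R)) (u : \bar R) :
  lbound S1 0 -> lbound S2 0 ->
  (forall a b, S1 a -> S2 b -> u <= a + b) ->
  u <= ereal_inf S1 + ereal_inf S2.
Proof.
move=> S10 S20 uS.
have i1 := le_ereal_inf_tmp S10.
have i2 := le_ereal_inf_tmp S20.
have [->|i1y] := eqVneq (ereal_inf S1) +oo.
  by rewrite addye ?leey// gt_eqF// (lt_le_trans _ i2)// ltNyr.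
have [->|i2y] := eqVneq (ereal_inf S2) +oo.
  by rewrite addey ?leey// gt_eqF// (lt_le_trans _ i1)// ltNyr.
have f1 : ereal_inf S1 \is a fin_num by rewrite ge0_fin_numE// ltey.
have f2 : ereal_inf S2 \is a fin_num by rewrite ge0_fin_numE// ltey.
apply/lee_addgt0Pr => e e0.
have e20 : (0 < e / 2)%R by rewrite divr_gt0.
have [a Sa alt] := lb_ereal_inf_adherent e20 f1.
have [b Sb blt] := lb_ereal_inf_adherent e20 f2.
apply: (le_trans (uS _ _ Sa Sb)).
by rewrite [in leRHS](splitr e) EFinD addeACA leeD// ltW.
Qed.

(** * Restriction, shift, concatenation and first hitting time of continuous paths *)

Section paths.
Context {R : realType} {E : completePseudoMetricType R}.
Implicit Types (f g : R -> E) (S T : R).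

Lemma cpath_le S T f : (S <= T)%R -> cpath T f -> cpath S f.
Proof.
by move=> ST; apply: continuous_subspaceW; apply: subset_itvl; rewrite bnd_simp.
Qed.

Lemma within_continuous_shift (a b s : R) f :
  {within `[(a + s)%R, (b + s)%R], continuous f} ->
  {within `[a, b], continuous (fun t => f (t + s)%R)}.
Proof.
move=> /subspace_continuousP cf; apply/subspace_continuousP => t /= tab.
have /cf {}cf : (t + s)%R \in `[(a + s)%R, (b + s)%R].
  by move: tab; rewrite /= !in_itv/= !lerD2r.
move=> V /cf; rewrite !nbhs_simpl/= => nV.
have ct : {for t, continuous (fun y : R => y + s)%R}.
  by apply: cvgD; [exact: cvg_id|exact: cvg_cst].
have := ct _ nV; rewrite !nbhs_simpl/= => {}ct.
rewrite /within/=; near=> y => yab.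
have : (y + s)%R \in `[(a + s)%R, (b + s)%R] -> V (f (y + s)%R) by near: y.
by apply; move: yab; rewrite /= !in_itv/= !lerD2r.
Unshelve. all: by end_near. Qed.

Lemma cpath_shift S T f : (0 <= S)%R -> cpath T f ->
  cpath (T - S) (fun t => f (S + t)%R).
Proof.
move=> S0 cf; rewrite /cpath/=.
have -> : (fun t => f (S + t)%R) = (fun t => f (t + S)%R).
  by apply/funext => t; rewrite addrC.
refine (@within_continuous_shift _ _ S _ _); rewrite add0r subrK.
by apply: continuous_subspaceW cf; apply: subset_itvr; rewrite bnd_simp.
Qed.

(** The junction time [S] is given to [f], so the left piece agrees with [f] on [0,S]
    unconditionally; only the right piece needs [f S = g 0]. *)
Definition path_cat S f g : R -> E :=
  fun t => if (t <= S)%R then f t else g (t - S)%R.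

Lemma path_catl S f g t : (t <= S)%R -> path_cat S f g t = f t.
Proof. by rewrite /path_cat => ->. Qed.

Lemma path_catr S f g t : f S = g 0%R -> (0 <= t)%R ->
  path_cat S f g (S + t)%R = g t.
Proof.
move=> fg t0; rewrite /path_cat; case: ifPn => [|_]; last by rewrite addrC addKr.
rewrite gerDl => t0'; have -> : t = 0%R by apply/eqP; rewrite eq_le t0' t0.
by rewrite addr0.
Qed.

Lemma cpath_cat S T f g : (0 <= S)%R -> (0 <= T)%R -> f S = g 0%R ->
  cpath S f -> cpath T g -> cpath (S + T) (path_cat S f g).
Proof.
move=> S0 T0 fg cf cg; rewrite /cpath/=.
rewrite (@itv_bndbnd_setU _ _ _ (BRight S)) ?bnd_simp ?lerDl//.
(* Continuity is glued along closed sets, so the second interval is closed up by adding [S], which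
   the first already contains. *)
have -> : `[0%R, S] `|` `]S, (S + T)%R] = `[0%R, S] `|` `[S, (S + T)%R].
  apply/seteqP; split=> t /= [->|]; rewrite ?in_itv/=; do ?[by left].
    by move=> /andP[/ltW -> ->]; right.
  rewrite le_eqVlt => /andP[/orP[/eqP <- _|-> ->]]; last by right.
  by left; rewrite S0 lexx.
apply: withinU_continuous; do ?exact: itv_closed.
- apply: subspace_eq_continuous cf => t /[!inE]/=; rewrite in_itv/= => /andP[_ tS].
  by rewrite /from_subspace path_catl.
- have cg' : {within `[S, (S + T)%R], continuous (fun t => g (t - S)%R)}.
    by refine (@within_continuous_shift _ _ (- S) _ _); rewrite subrr addrAC subrr add0r.
  apply: subspace_eq_continuous cg' => t /[!inE]/=.
  rewrite in_itv/= => /andP[St _].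
  rewrite /from_subspace -[in RHS](subrKC S t) path_catr// subr_ge0//.
Qed.

(** [S] is the infimum of the set [Z] of times at which [xi \o f] is at least [l]. Before it the
    values are below [l], by definition of [Z]; at it the value is exactly [l], by continuity. *)
Lemma first_hitting_time (xi : E -> R) (l T : R) f : continuous xi ->
  (0 <= T)%R -> cpath T f -> (xi (f 0%R) <= l <= xi (f T))%R ->
  exists S, [/\ (0 <= S <= T)%R, xi (f S) = l &
    forall t, (0 <= t <= S)%R -> (xi (f t) <= l)%R].
Proof.
move=> cxi T0 cf /andP[f0l lfT].
have cg : {within `[0%R, T], continuous (xi \o f)}.
  apply/subspace_continuousP => t tT.
  have /subspace_continuousP/(_ t tT) cft := cf.
  exact: cvg_comp cft (cxi (f t)).
pose Z := [set t | (0 <= t <= T)%R /\ (l <= xi (f t))%R].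
have lbZ : lbound Z 0%R by move=> t [/andP[]].
have ZT : Z T by rewrite /Z/= T0 lexx.
have hZ : has_inf Z by split; [exists T|exists 0%R].
have leZ t : Z t -> (inf Z <= t)%R by apply: ge_inf; case: hZ.
have Z0 : (0 <= inf Z)%R by apply: lb_le_inf => //; case: hZ.
have leT : (inf Z <= T)%R by exact: leZ.
have ZinfZ : Z (inf Z).
  split; first by rewrite Z0 leT.
  (* A value below [l] at [inf Z] would stay below [l] at all nearby times of [0,T], but [Z] has
     points arbitrarily close to its infimum. *)
  rewrite leNgt; apply/negP => glt.
  have /subspace_continuousP/(_ (inf Z)) := cg.
  rewrite /= in_itv/= Z0 leT => /(_ isT)/(_ [set y | (y < l)%R]).
  rewrite nbhs_simpl/= => /(_ (open_nbhs_nbhs (conj (@open_lt _ l) glt))).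
  rewrite nbhs_simpl/= => /nbhs_ballP[e /= e0 He].
  have [z Zz zlt] := inf_adherent e0 hZ.
  have /He : ball (inf Z) e z.
    by rewrite /ball/= distrC ger0_norm ?subr_ge0 ?leZ// ltrBlDl.
  case: Zz => zT lz /=; rewrite in_itv/= => /(_ zT).
  by rewrite ltNge lz.
have cgZ : {within `[0%R, inf Z], continuous (xi \o f)}.
  by apply: continuous_subspaceW cg; apply: subset_itvl; rewrite bnd_simp.
(* The intermediate value theorem on [0, [inf Z]] yields a time [c] with value [l]; it lies in [Z],
   so it can only be [inf Z]. *)
have [|c] := IVT Z0 cgZ (v := l).
  by rewrite ge_min f0l/= le_max ZinfZ.2 orbT.
rewrite in_itv/= => /andP[c0 cS] fc.
have cE : c = inf Z.
  by apply/eqP; rewrite eq_le cS leZ//; split; rewrite ?c0 ?(le_trans cS)//= fc.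
rewrite cE /= in fc; exists (inf Z); split; rewrite ?Z0//.
move=> t /andP[t0]; rewrite le_eqVlt => /orP[/eqP ->|tS]; first by rewrite fc.
rewrite leNgt; apply/negP => lt; move: (tS); rewrite ltNge => /negP; apply.
apply: leZ; split; last exact: ltW.
by rewrite t0 (le_trans (ltW tS) leT).
Qed.

End paths.

(** * Monotonicity and triangle inequalities for the quasipotential *)

Section quasipotential_theory.
Context {R : realType} {E : completePseudoMetricType R}.
Variable I : R -> (R -> E) -> \bar R.
Hypothesis hI : good_additive_rate I.
Implicit Types (D C : set E) (x y z : E) (f : R -> E).

Lemma path_costs_ge0 D x y : lbound (path_costs I `[0%R, +oo[ D x y) 0.
Proof.
move=> _ [T [f [T0 cf _ _ ->]]]; apply: (rate_ge0 hI) => //.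
by move: T0; rewrite /= in_itv/= andbT.
Qed.

Lemma quasipotential_ge0 D x y : 0 <= quasipotential I D x y.
Proof. exact: le_ereal_inf_tmp (@path_costs_ge0 _ _ _). Qed.

Lemma quasipotential_set_ge0 D C1 C2 : 0 <= quasipotential_set I D C1 C2.
Proof.
by apply: le_ereal_inf_tmp => _ [x [y [_ _ ->]]]; exact: quasipotential_ge0.
Qed.

Lemma quasipotential_set_le D C1 C2 x y : C1 x -> C2 y ->
  quasipotential_set I D C1 C2 <= quasipotential I D x y.
Proof. by move=> C1x C2y; apply: ereal_inf_lbound; exists x, y. Qed.

Lemma quasipotential_le D x y T f : (0 <= T)%R -> cpath T f ->
  f 0%R = x -> f T = y -> (forall t, (0 <= t <= T)%R -> D (f t)) ->
  quasipotential I D x y <= I T f.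
Proof.
move=> T0 cf f0 fT fD; apply: ereal_inf_lbound; exists T, f; split=> //.
- by rewrite /= in_itv/= T0.
- by move=> _ [t tT <-]; apply: fD; move: tT; rewrite /= in_itv.
Qed.

Lemma quasipotential_subset D1 D2 x y : D1 `<=` D2 ->
  quasipotential I D2 x y <= quasipotential I D1 x y.
Proof.
move=> D12; apply: ereal_inf_le_tmp => c [T [f [JT cf fxy fD ->]]].
by exists T, f; split=> //; exact: subset_trans D12.
Qed.

(** Concatenating a path from [x] to [y] with one from [y] to [z] gives an admissible path, whose
    cost is the sum of the two by additivity. *)
Lemma quasipotential_triangle D x y z :
  quasipotential I D x z <= quasipotential I D x y + quasipotential I D y z.
Proof.
apply: le_ereal_infD; [exact: path_costs_ge0|exact: path_costs_ge0|].
move=> _ _ [S [f [+ cf [f0 fS] fD ->]]] [T [g [+ cg [g0 gT] gD ->]]].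
rewrite /= !in_itv/= !andbT => S0 T0.
have fg : f S = g 0%R by rewrite fS g0.
have ST0 : (0 <= S + T)%R by rewrite addr_ge0.
have cfg := cpath_cat S0 T0 fg cf cg.
have SST : (S <= S + T)%R by rewrite lerDl.
(* Paths are total functions on [R], and the concatenation differs from [f] after [S]; [rate_local]
   identifies the costs, here and for [g]. *)
have -> : I S f = I S (path_cat S f g).
  apply: (rate_local hI) => //; first exact: cpath_le cfg.
  by move=> t; rewrite in_itv/= => /andP[_ tS]; rewrite path_catl.
have -> : I T g = I (S + T - S)%R (fun t => path_cat S f g (S + t)%R).
  have STS : (S + T - S = T)%R by rewrite addrAC subrr add0r.
  have := cpath_shift S0 cfg; rewrite STS => cs.
  apply: (rate_local hI) => //.
  by move=> t; rewrite in_itv/= => /andP[t0 _]; rewrite path_catr.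
rewrite -(rate_additive hI)//; apply: quasipotential_le => //.
- by rewrite path_catl.
- by rewrite path_catr.
- move=> t /andP[t0 tST]; have [tS|St] := leP t S.
    by rewrite path_catl//; apply: fD; exists t => //=; rewrite in_itv/= t0.
  rewrite -(subrKC S t) path_catr ?subr_ge0 ?(ltW St)//.
  apply: gD; exists (t - S)%R => //=.
  by rewrite in_itv/= subr_ge0 (ltW St) lerBlDl.
Qed.

Lemma quasipotential_set_triangle D C x y :
  quasipotential_set I D [set x] C <=
  quasipotential I D x y + quasipotential_set I D [set y] C.
Proof.
(* The first term is viewed as the infimum of a singleton so that [le_ereal_infD] applies. *)
rewrite -[quasipotential I D x y]ereal_inf1; apply: le_ereal_infD.
- by move=> _ ->; exact: quasipotential_ge0.
- by move=> _ [? [z [_ _ ->]]]; exact: quasipotential_ge0.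
- move=> _ _ -> [_ [z [-> Cz ->]]].
  apply: (@le_trans _ _ (quasipotential I D x z)).
    exact: quasipotential_set_le.
  exact: quasipotential_triangle.
Qed.

End quasipotential_theory.

Theorem theorem3p18 (R : realType) (E : completePseudoMetricType R)
    (hE : polish E) (A : set E) (hA : borel A)
    (xi : E -> R) (hxi : continuous xi)
    (x0 : E) (lB : R) (hlB : (xi x0 <= lB)%R)
    (X : R -> strong_markov_process E) (I : R -> (R -> E) -> \bar R)
    (hI : good_additive_rate I)
    (hLDP : forall T : R, (0 < T)%R -> locally_uniform_LDP X I T)
    (hU : Uset I A [set x0] (level xi lB) < +oo) :
  (forall l : R, (xi x0 <= l <= lB)%R -> 0 <= Loss I A xi x0 lB l) /\
  (forall l : R, (xi x0 <= l <= lB)%R ->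
     (exists xs : E,
        [/\ level xi l xs,
            U I A x0 xs = Uset I A [set x0] (level xi l) &
            Uset I A [set xs] (level xi lB) =
              Uset I A (level xi l) (level xi lB)]) ->
     Loss I A xi x0 lB l = 0).
Proof.
set m := fun l => ereal_inf
  [set Ul I A xi l x0 x + 2%:E * Uset I A [set x] (level xi lB) | x in level xi l].
set u := Uset I A [set x0] (level xi lB) in hU *.
set k := fun l => Uset I A [set x0] (level xi l).
have u0 : 0 <= u by exact: (quasipotential_set_ge0 hI).
have k0 l : 0 <= k l by exact: (quasipotential_set_ge0 hI).
have m0 l : 0 <= m l.
  apply: le_ereal_inf_tmp => _ [x _ <-]; apply: adde_ge0.
    exact: (quasipotential_ge0 hI).
  by apply: mule_ge0 => //; exact: (quasipotential_set_ge0 hI).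
(* The sign of Loss is stated additively, since subtraction in the extended reals is safe only once
   the terms are known to be finite. *)
have mk l : (xi x0 <= l <= lB)%R -> m l + k l <= 2%:E * u.
  (* The factor 2 is moved to the left so that [u] stands alone as an infimum and the bound can be
     checked path by path; it is moved back once a path is fixed. *)
  move=> /andP[x0l llB]; rewrite -lee_pdivrMl//.
  apply: le_ereal_inf_tmp => _ [_ [y [-> yB ->]]].
  apply: le_ereal_inf_tmp => _ [T [f [+ cf [f0 fT] fD ->]]].
  rewrite /= in_itv/= andbT => T0; rewrite lee_pdivrMl//.
  have fA t : (0 <= t <= T)%R -> (~` A) (f t).
    by move=> tT; apply: fD; exists t => //=; rewrite in_itv.
  have [|S [/andP[S0 ST] fS Sl]] := @first_hitting_time _ _ xi l T f hxi T0 cf.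
    by rewrite f0 fT x0l yB.
  have cS := cpath_le ST cf.
  have cS' := cpath_shift S0 cf.
  have fSA t : (0 <= t <= S)%R -> (~` A) (f t).
    by move=> /andP[t0 tS]; apply: fA; rewrite t0 (le_trans tS).
  have UlS : Ul I A xi l x0 (f S) <= I S f.
    by apply: quasipotential_le => // t tS; split; [exact: Sl|exact: fSA].
  have kS : k l <= I S f.
    apply: (@le_trans _ _ (U I A x0 (f S))); first exact: quasipotential_set_le.
    exact: quasipotential_le.
  have BS : Uset I A [set f S] (level xi lB) <= I (T - S)%R (fun t => f (S + t)%R).
    apply: (@le_trans _ _ (U I A (f S) y)); first exact: quasipotential_set_le.
    apply: quasipotential_le => //; rewrite ?subr_ge0 ?addr0 ?subrKC//.
    by move=> t /andP[t0 tST]; apply: fA; rewrite addr_ge0//= -lerBrDl.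
  rewrite (rate_additive hI S0 ST cf).
  have I1 : 0 <= I S f by exact: (rate_ge0 hI).
  have I2 : 0 <= I (T - S)%R (fun t => f (S + t)%R).
    by apply: (rate_ge0 hI) => //; rewrite subr_ge0.
  (* Of the two copies of the cost up to [S], one pays for [Ul] inside [m l], the other for
     [k l]. *)
  rewrite ge0_muleDr// (mule_natl (I S f) 2) mule2n addeAC.
  apply: leeD => //.
  apply: (@le_trans _ _ (I S f + 2%:E * Uset I A [set f S] (level xi lB)));
    last by rewrite leeD2l// lee_pmul2l.
  apply: le_trans (leeD UlS (lexx _)).
  by apply: ereal_inf_lbound; exists (f S).
(* [u] is finite by [hU], and [mk] passes this on to the nonnegative [m l] and [k l]; both claims
   then reduce to real arithmetic. *)
have fin l : (xi x0 <= l <= lB)%R ->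
    [/\ u \is a fin_num, m l \is a fin_num & k l \is a fin_num].
  move=> /mk mkl; have uf : u \is a fin_num by rewrite ge0_fin_numE.
  have : m l + k l \is a fin_num.
    rewrite ge0_fin_numE ?adde_ge0// (le_lt_trans mkl)//.
    by rewrite -(fineK uf) -EFinM ltry.
  by rewrite fin_numD => /andP[].
split=> l lB'; have [uf mf kf] := fin l lB'; have := mk l lB'.
  rewrite /Loss -/u -/(m l) -/(k l) -(fineK uf) -(fineK mf) -(fineK kf).
  by rewrite -EFinM -!EFinB -EFinD !lee_fin; lra.
move=> + [xs [xsl Uxs UxsB]] => mkl.
have km : 2%:E * u <= m l + k l.
  rewrite -leeBlDr//; apply: le_ereal_inf_tmp => _ [x xl <-]; rewrite leeBlDr//.
  have kx : k l <= Ul I A xi l x0 x.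
    apply: (@le_trans _ _ (U I A x0 x)); first exact: quasipotential_set_le.
    by apply: quasipotential_subset => z [].
  (* By the second property of [xs], no other point of the level set reaches the target at a lower
     cost. *)
  have Bx : Uset I A [set xs] (level xi lB) <= Uset I A [set x] (level xi lB).
    rewrite UxsB; apply: ereal_inf_le_tmp => _ [_ [y [-> yB ->]]].
    by exists x, y.
  have tri : u <= k l + Uset I A [set xs] (level xi lB).
    by rewrite /k -Uxs; exact: quasipotential_set_triangle.
  have b0 : 0 <= Uset I A [set xs] (level xi lB) by exact: (quasipotential_set_ge0 hI).
  apply: (@le_trans _ _ (2%:E * (k l + Uset I A [set xs] (level xi lB)))).
    by rewrite lee_pmul2l.
  (* One copy of [k l] is kept, the other is bounded by [Ul] through [kx]. *)
  rewrite ge0_muleDr// (mule_natl (k l) 2) mule2n addeAC leeD// leeD//.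
  by rewrite lee_pmul2l.
move: mkl km; rewrite /Loss -/u -/(m l) -/(k l).
rewrite -(fineK uf) -(fineK mf) -(fineK kf) -EFinM -!EFinB -EFinD !lee_fin.
by move=> h1 h2; congr EFin; lra.
Qed.
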